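(* Let $\mathcal{H}$ be a finite central simplicial hyperplane arrangement in $\mathbb{R}^n$ such that the normal vector to every hyperplane of $\mathcal{H}$ can be taken to lie in the positive orthant $\mathbb{R}_{\ge0}^n$, and let $\Sigma_{\mathcal{H}}$ be its fan. Then for every admissible partition $\mathfrak{P}$ of $\Sigma_{\mathcal{H}}$ the category $\mathfrak{C}(\mathcal{H},\mathfrak{P}):=\mathfrak{C}(\Sigma_{\mathcal{H}},\mathfrak{P})$ admits a faithful functor to some group (viewed as a groupoid with one object).
   Context: **Arrangements.** A finite central hyperplane arrangement $\mathcal{H}$ in $\mathbb{R}^n$ is a finite set of linear hyperplanes. Its regions are the connected components of $\mathbb{R}^n\setminus\bigcup_{H\in\mathcal{H}}H$. It is simplicial if the closure of every region is a simplicial cone (generated by $n$ linearly independent vectors). $\Sigma_{\mathcal{H}}$ is the finite complete simplicial fan consisting of the closures of the regions and all their faces. **Fans.** For a simplicial fan $\Sigma$ in $\mathbb{R}^n$ and $\sigma\in\Sigma$ let $\mathrm{star}(\sigma)=\{\tau\in\Sigma:\sigma\subseteq\tau\}$, let $\pi_\sigma:\mathbb{R}^n\to\mathrm{span}\{\sigma\}^\perp$ be the orthogonal projection, and $\pi_\sigma(\mathrm{star}(\sigma))=\{\pi_\sigma(\tau):\tau\in\mathrm{star}(\sigma)\}$. **Admissible partitions.** Let $\mathcal{E}_{\sigma_1}=\{\sigma_2\in\Sigma:\mathrm{span}\{\sigma_1\}^\perp=\mathrm{span}\{\sigma_2\}^\perp,\ \pi_{\sigma_1}(\mathrm{star}(\sigma_1))=\pi_{\sigma_2}(\mathrm{star}(\sigma_2))\}$.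 Consider a partition $\mathfrak{P}$ of $\Sigma$ each of whose blocks is contained in some $\mathcal{E}_\sigma$; write $\sigma_1\sim\sigma_2$ if they lie in the same block, and $[\sigma]$ for the block of $\sigma$. $\mathfrak{P}$ is admissible if whenever $\sigma_1\sim\sigma_2$ and $\tau_i\in\mathrm{star}(\sigma_i)$ satisfy $\pi_{\sigma_1}(\tau_1)=\pi_{\sigma_2}(\tau_2)$, then $\tau_1\sim\tau_2$. **The category $\mathfrak{C}(\Sigma,\mathfrak{P})$.** Objects are the blocks $[\sigma]$. For $\sigma\subseteq\tau$ let $f_{\sigma\tau}$ be the unique morphism in the poset category $\Sigma$ (cones ordered by inclusion). Morphisms $[\sigma]\to[\tau]$ are equivalence classes $[f_{\sigma_i\tau_j}]$ with $\sigma_i\in[\sigma]$, $\tau_j\in[\tau]$, $\sigma_i\subseteq\tau_j$, where $f_{\sigma_1\tau_1}\sim f_{\sigma_2\tau_2}$ iff $\pi_{\sigma_1}(\tau_1)=\pi_{\sigma_2}(\tau_2)$. Composition: $[f_{\kappa\tau}]\circ[f_{\sigma\kappa}]=[f_{\sigma\tau}]$. *)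

(* Defs.v *)
From HB Require Import structures.
From mathcomp Require Import all_boot all_order all_algebra.
From mathcomp Require Import all_classical all_reals all_analysis.

Set Implicit Arguments.
Unset Strict Implicit.
Unset Printing Implicit Defensive.

Import Order.TTheory GRing.Theory Num.Theory.
Import numFieldNormedType.Exports.

Local Open Scope classical_set_scope.
Local Open Scope ring_scope.

Record category : Type := Category {
  obj : Type;
  hom : obj -> obj -> Type;
  idm : forall a, hom a a;
  compm : forall a b c, hom b c -> hom a b -> hom a c;
  compA : forall a b c d (h : hom c d) (g : hom b c) (f : hom a b),
    compm h (compm g f) = compm (compm h g) f;
  comp1m : forall a b (f : hom a b), compm (idm b) f = f;
  compm1 : forall a b (f : hom a b), compm f (idm a) = f }.

Record functor (C D : category) : Type := Functor {
  fobj : obj C -> obj D;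
  fhom : forall a b, hom a b -> hom (fobj a) (fobj b);
  fhom_id : forall a, fhom (idm a) = idm (fobj a);
  fhom_comp : forall a b c (g : hom b c) (f : hom a b),
    fhom (compm g f) = compm (fhom g) (fhom f) }.

Definition faithful (C D : category) (F : functor C D) : Prop :=
  forall a b : obj C, injective (@fhom C D F a b).

Definition group_category (G : groupType) : category :=
  @Category unit (fun _ _ => G) (fun _ => 1%g) (fun _ _ _ g f => (g * f)%g)
    (fun _ _ _ _ => @mulgA G) (fun _ _ => @mul1g G) (fun _ _ => @mulg1 G).

Section Euclidean.
Variables (R : realType) (n : nat).
Local Notation V := 'rV[R]_n.
Implicit Types x y z a : V.

Definition dot x y : R := (x *m y^T) 0 0.

Lemma dotC x y : dot x y = dot y x.
Proof. by rewrite /dot -[y in RHS]trmxK -trmx_mul [RHS]mxE. Qed.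

Lemma dotDl x y z : dot (x + y) z = dot x z + dot y z.
Proof. by rewrite /dot mulmxDl mxE. Qed.

Lemma dotZl c x z : dot (c *: x) z = c * dot x z.
Proof. by rewrite /dot -scalemxAl mxE. Qed.

Lemma dotNl x z : dot (- x) z = - dot x z.
Proof. by rewrite -scaleN1r dotZl mulN1r. Qed.

Lemma dotBl x y z : dot (x - y) z = dot x z - dot y z.
Proof. by rewrite dotDl dotNl. Qed.

Lemma dot0l z : dot 0 z = 0.
Proof. by rewrite -(scale0r 0) dotZl mul0r. Qed.

Lemma dotDr x y z : dot z (x + y) = dot z x + dot z y.
Proof. by rewrite dotC dotDl !(dotC z). Qed.

Lemma dotZr c x z : dot z (c *: x) = c * dot z x.
Proof. by rewrite dotC dotZl (dotC z). Qed.

Lemma dotNr x z : dot z (- x) = - dot z x.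
Proof. by rewrite dotC dotNl (dotC z). Qed.

Lemma dotBr x y z : dot z (x - y) = dot z x - dot z y.
Proof. by rewrite dotDr dotNr. Qed.

Lemma dot0r z : dot z 0 = 0.
Proof. by rewrite dotC dot0l. Qed.

Lemma dotE x y : dot x y = \sum_i x 0 i * y 0 i.
Proof. by rewrite /dot mxE; apply: eq_bigr => i _; rewrite mxE. Qed.

Lemma dot_eq0 x : dot x x = 0 -> x = 0.
Proof.
rewrite dotE => /eqP; rewrite psumr_eq0 => [/allP x0|i _]; last first.
  by rewrite -expr2 sqr_ge0.
apply/rowP => i; rewrite mxE; have := x0 i (mem_index_enum i).
by rewrite -expr2 sqrf_eq0 => /eqP.
Qed.

Section Span.
Implicit Types A B : set V.

Definition lspan A : set V :=
  [set x | exists2 s : seq V, [set` s] `<=` A & x \in span s].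

Definition orthocomp A : set V := [set y | forall x, A x -> dot x y = 0].

(* The orthogonal projection onto [orthocomp (lspan A)]; [orth_projP] and
   [orth_proj_uniq] show that the choice operator [xget] always finds exactly
   one point here. *)
Definition orth_proj A x : V :=
  xget 0 [set y | orthocomp (lspan A) y /\ lspan A (x - y)].

Lemma lspan_sub A : A `<=` lspan A.
Proof.
move=> x Ax; exists [:: x]; last by rewrite memv_span ?inE.
by move=> y /=; rewrite inE => /eqP ->.
Qed.

Lemma lspanD A x y : lspan A x -> lspan A y -> lspan A (x + y).
Proof.
move=> [s sA xs] [t tA yt]; exists (s ++ t); last by rewrite span_cat memv_add.
by move=> z /=; rewrite mem_cat => /orP[/sA|/tA].
Qed.

Lemma lspanZ A c x : lspan A x -> lspan A (c *: x).
Proof. by move=> [s sA xs]; exists s => //; rewrite memvZ. Qed.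

Lemma lspanN A x : lspan A x -> lspan A (- x).
Proof. by move=> Ax; rewrite -scaleN1r; exact: lspanZ. Qed.

Lemma lspanB A x y : lspan A x -> lspan A y -> lspan A (x - y).
Proof. by move=> Ax Ay; apply: lspanD => //; exact: lspanN. Qed.

Lemma lspan0 A : lspan A 0.
Proof. by exists [::]; rewrite ?mem0v. Qed.

Lemma lspan_min A B : A `<=` B -> B 0 ->
    (forall x y, B x -> B y -> B (x + y)) -> (forall c x, B x -> B (c *: x)) ->
  lspan A `<=` B.
Proof.
move=> AB B0 BD BZ x [s sA] xs.
rewrite (coord_span (X := in_tuple s) xs).
apply: big_ind => // i _; apply/BZ/AB/sA.
by rewrite /= mem_nth.
Qed.

Lemma lspanS A B : A `<=` B -> lspan A `<=` lspan B.
Proof. by move=> AB x [s sA xs]; exists s => //; exact: subset_trans AB. Qed.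

Lemma orthocomp_lspan A y : (forall x, A x -> dot x y = 0) ->
  orthocomp (lspan A) y.
Proof.
move=> Ay; apply: lspan_min => //=.
- by rewrite dot0l.
- by move=> u v u0 v0; rewrite dotDl u0 v0 addr0.
- by move=> c u u0; rewrite dotZl u0 mulr0.
Qed.

Lemma residual (s : seq V) x :
  exists2 y, forall z, z \in s -> dot z y = 0 & x - y \in span s.
Proof.
elim: s x => [|a s IH] x; first by exists x => //; rewrite subrr mem0v.
have [y yo xy] := IH x; have [b bo ab] := IH a.
have sP w : (forall z, z \in s -> dot z w = 0) ->
    forall u, u \in span s -> dot u w = 0.
  move=> wo u us; have := @orthocomp_lspan [set` s] w wo.
  by apply; exists s.
have ss u : u \in span s -> u \in span (a :: s).
  by move=> us; rewrite span_cons -[u]add0r memv_add ?mem0v.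
have ba : b \in span (a :: s).
  rewrite -[b](subKr a) rpredB//; first by rewrite memv_span ?inE ?eqxx.
  exact: ss.
pose c := dot b y / dot b b; exists (y - c *: b); last first.
  by rewrite opprB addrCA rpredD ?memvZ// ss.
move=> z; rewrite inE => /orP[/eqP ->|zs]; last first.
  by rewrite dotBr dotZr yo// bo// mulr0 subr0.
have {1}-> : a = b + (a - b) by rewrite addrCA subrr addr0.
have by0 : dot (b + (a - b)) (y - c *: b) = dot b (y - c *: b).
  by rewrite dotDl [X in _ + X]dotBr dotZr !(sP _ _ _ ab)// mulr0 subr0 addr0.
rewrite by0 dotBr dotZr /c.
have [b0|b0] := eqVneq (dot b b) 0.
  by rewrite (dot_eq0 b0) !dot0l mulr0 subr0.
by rewrite divfK// subrr.
Qed.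

Lemma lspan_finite A :
  exists2 s : seq V, [set` s] `<=` A & A `<=` [set x | x \in span s].
Proof.
pose D d := `[< exists2 s : seq V, [set` s] `<=` A & \dim (span s) = d >].
have D0 : exists d, D d.
  by exists (\dim (span ([::] : seq V))); apply/asboolP; exists [::].
have Dn d : D d -> (d <= \dim {:V})%N.
  by move=> /asboolP[s _ <-]; rewrite dimvS ?subvf.
case: (ex_maxnP D0 Dn) => d /asboolP[s sA sd] dmax; exists s => // a Aa /=.
have /asboolP/dmax : exists2 t : seq V, [set` t] `<=` A &
    \dim (span t) = \dim (span (a :: s)).
  exists (a :: s) => // z /=.
  by rewrite inE => /orP[/eqP ->//|/sA].
have sub : (span s <= span (a :: s))%VS by rewrite span_cons addvSr.
rewrite -sd => le; have /eqP -> : span s == span (a :: s) by rewrite eqEdim sub.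
by rewrite memv_span// inE eqxx.
Qed.

Lemma orth_projP A x :
  orthocomp (lspan A) (orth_proj A x) /\ lspan A (x - orth_proj A x).
Proof.
apply: (@xgetPex _ 0 [set y | orthocomp (lspan A) y /\ lspan A (x - y)]).
have [s sA As] := lspan_finite A; have [y yo xy] := residual s x.
exists y; split; last by exists s.
apply: orthocomp_lspan => u /As us.
by apply: (@orthocomp_lspan [set` s] y yo); exists s.
Qed.

Lemma orth_proj_uniq A x y :
  orthocomp (lspan A) y -> lspan A (x - y) -> orth_proj A x = y.
Proof.
move=> yo xy; have [zo xz] := orth_projP A x; set z := orth_proj A x in zo xz *.
apply/eqP; rewrite -subr_eq0; apply/eqP/dot_eq0.
have dA : lspan A (z - y).
  by rewrite -(subrKA x) -[z - x]opprB; apply/lspanD/xy/lspanN.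
by rewrite [in LHS]dotBr zo// yo// subrr.
Qed.

Lemma orth_proj_eq A x y : orth_proj A x = orth_proj A y <-> lspan A (x - y).
Proof.
have [_ xz] := orth_projP A x; have [yo yz] := orth_projP A y; split=> [xy|xy].
  rewrite -(subrKA (orth_proj A x)); apply: lspanD => //.
  by rewrite xy -opprB; exact: lspanN.
apply: orth_proj_uniq => //.
by rewrite -(subrKA y); apply: lspanD.
Qed.

Lemma orthocomp_eq_lspan A B :
  orthocomp (lspan A) = orthocomp (lspan B) -> lspan A = lspan B.
Proof.
suff sub A' B' : orthocomp (lspan A') = orthocomp (lspan B') ->
    lspan A' `<=` lspan B'.
  by move=> AB; apply/seteqP; split; apply: sub.
move=> AB x Ax; have [ro rx] := orth_projP B' x; set r := orth_proj B' x in ro rx.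
have r0 : r = 0.
  apply: dot_eq0; rewrite -{1}[r](subKr x) dotBl (ro _ rx) subr0.
  by move: ro; rewrite -AB; apply.
by rewrite r0 subr0 in rx.
Qed.

Lemma orth_proj_lspan A B : lspan A = lspan B -> orth_proj A = orth_proj B.
Proof. by move=> AB; apply/funext => x; rewrite /orth_proj AB. Qed.

End Span.

Definition orthant k : set 'rV[R]_k := [set c | forall i, 0 <= c 0 i].
Arguments orthant : clear implicits.

Definition hyperplane a : set V := [set x | dot a x = 0].

(* The cone generated by the rows of [M]. *)
Definition cone_of k (M : 'M[R]_(k, n)) : set V :=
  [set c *m M | c in orthant k].

Definition simplicial_cone k (C : set V) : Prop :=
  exists2 M : 'M[R]_(k, n), row_free M & C = cone_of M.

(* [u = 0] is allowed, so that a cone is a face of itself. *)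
Definition face (C F : set V) : Prop :=
  exists2 u, (forall x, C x -> 0 <= dot u x) & F = C `&` hyperplane u.

(* Finiteness plays no role in the construction of the category below, and is
   not required. *)
Record simplicial_fan (S : set (set V)) : Prop := SimplicialFan {
  fan_simplicial : forall C, S C -> exists k, simplicial_cone k C;
  fan_face : forall C F, S C -> face C F -> S F;
  fan_inter : forall C D, S C -> S D -> face C (C `&` D) }.

Definition star (S : set (set V)) (s : set V) : set (set V) :=
  [set t | S t /\ s `<=` t].

Definition proj_cone (s t : set V) : set V := orth_proj s @` t.

Definition proj_star (S : set (set V)) (s : set V) : set (set V) :=
  proj_cone s @` star S s.

Definition identifiable (S : set (set V)) (s1 : set V) : set (set V) :=
  [set s2 | [/\ S s2, orthocomp (lspan s1) = orthocomp (lspan s2)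
            & proj_star S s1 = proj_star S s2]].

Definition same_block (P : set (set (set V))) (s1 s2 : set V) : Prop :=
  exists2 B, P B & B s1 /\ B s2.

Record admissible_partition (S : set (set V)) (P : set (set (set V))) : Prop :=
  AdmissiblePartition {
    adm_partition : partition P id S;
    adm_block : forall B, P B -> exists2 s, S s & B `<=` identifiable S s;
    adm_admissible : forall s1 s2 t1 t2, same_block P s1 s2 ->
      star S s1 t1 -> star S s2 t2 -> proj_cone s1 t1 = proj_cone s2 t2 ->
      same_block P t1 t2 }.

Record convex_cone (C : set V) : Prop := ConvexCone {
  cone0 : C 0;
  coneD : forall x y, C x -> C y -> C (x + y);
  coneZ : forall c x, 0 <= c -> C x -> C (c *: x) }.

Lemma cone_of_convex k (M : 'M[R]_(k, n)) : convex_cone (cone_of M).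
Proof.
split=> [|_ _ [c c0 <-] [d d0 <-]|e _ e0 [c c0 <-]].
- by exists 0; rewrite ?mul0mx// => i; rewrite mxE.
- by exists (c + d); rewrite ?mulmxDl// => i; rewrite mxE addr_ge0.
- by exists (e *: c); rewrite -?scalemxAl// => i; rewrite mxE mulr_ge0.
Qed.

Lemma simplicial_convex k C : simplicial_cone k C -> convex_cone C.
Proof. by move=> [M _ ->]; exact: cone_of_convex. Qed.

Definition extreme (C F : set V) : Prop :=
  forall x y, C x -> C y -> F (x + y) -> F x.

Lemma face_convex C F : convex_cone C -> face C F -> convex_cone F.
Proof.
move=> cC [u uC ->]; split.
- by split; [exact: cone0|rewrite /hyperplane /= dot0r].
- move=> x y [Cx ux] [Cy uy]; split; first exact: coneD.
  by rewrite /hyperplane /= dotDr ux uy addr0.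
- move=> c x c0 [Cx ux]; split; first exact: coneZ.
  by rewrite /hyperplane /= dotZr ux mulr0.
Qed.

Lemma face_sub C F : face C F -> F `<=` C.
Proof. by move=> [u _ ->]; exact: subIsetl. Qed.

Lemma face_extreme C F : face C F -> extreme C F.
Proof.
move=> [u uC ->] x y Cx Cy [_ uxy]; split => //; rewrite /hyperplane /= in uxy *.
apply/eqP; rewrite eq_le uC// andbT -uxy dotDr lerDl; exact: uC.
Qed.

Lemma face_refl C : face C C.
Proof.
exists 0 => [x _|]; first by rewrite dot0l.
by apply/seteqP; split=> [x Cx|x []//]; split=> //; rewrite /hyperplane /= dot0l.
Qed.

Section SimplicialFaces.
Variables (k : nat) (M : 'M[R]_(k, n)) (F : set V).
Hypotheses (Mfree : row_free M) (cF : convex_cone F) (FM : F `<=` cone_of M)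
  (eF : extreme (cone_of M) F).

Let inF i := `[< F (row i M) >].

Let rowM i c : 0 <= c -> cone_of M (c *: row i M).
Proof.
move=> c0; exists (c *: delta_mx 0 i); last by rewrite -scalemxAl -rowE.
by move=> j; rewrite !mxE mulr_ge0// ler0n.
Qed.

Let coef_inF c i : orthant k c -> F (c *m M) -> ~~ inF i -> c 0 i = 0.
Proof.
move=> c0 Fc; apply: contraNeq => ci; apply/asboolP.
rewrite -[row i M]scale1r -(mulVf ci) -scalerA; apply: coneZ => //.
  by rewrite invr_ge0.
pose d := c - c 0 i *: delta_mx 0 i.
apply: (eF (y := d *m M)); first exact: rowM.
  exists d => // j; rewrite !mxE eqxx/=.
  by have [->|_] := eqVneq j i; rewrite ?mulr1 ?subrr ?mulr0 ?subr0.
by rewrite /d mulmxBl -scalemxAl -rowE addrC subrK.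
Qed.

Let sum_inF c : orthant k c -> (forall i, ~~ inF i -> c 0 i = 0) -> F (c *m M).
Proof.
move=> c0 cF0; rewrite mulmx_sum_row; apply: big_ind => [||i _].
- exact: cone0.
- exact: coneD.
- have [/asboolP Fi|Fi] := boolP (inF i); first exact: coneZ.
  by rewrite cF0// scale0r; exact: cone0.
Qed.

Lemma extreme_face : face (cone_of M) F.
Proof.
pose e : 'rV[R]_k := \row_i (~~ inF i)%:R.
have uE c : dot (e *m (pinvmx M)^T) (c *m M) = \sum_i (~~ inF i)%:R * c 0 i.
  rewrite /dot (trmx_mul c) mulmxA -(mulmxA e) -(trmx_mul M) mulmxVp// trmx1.
  rewrite mulmx1 mxE; apply: eq_bigr => i _; by rewrite !mxE.
exists (e *m (pinvmx M)^T) => [_ [c c0 <-]|].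
  by rewrite uE; apply: sumr_ge0 => i _; rewrite mulr_ge0 ?ler0n.
apply/seteqP; split=> [x Fx|_ [[c c0 <-]]].
  split; first exact: FM.
  have [c c0 cx] := FM Fx; rewrite /hyperplane /= -cx uE big1// => i _.
  have [/=|/coef_inF->//] := boolP (inF i); rewrite ?mul0r ?mulr0//.
  by rewrite cx.
rewrite /hyperplane /= uE => /eqP; rewrite psumr_eq0 => [/allP z|i _]; last first.
  by rewrite mulr_ge0 ?ler0n.
apply: sum_inF => // i Fi; have := z i (mem_index_enum i).
by rewrite Fi mul1r => /eqP.
Qed.

Lemma extreme_simplicial : exists j, simplicial_cone j F.
Proof.
pose I := [set i | inF i]%SET; pose f : 'I_#|I| -> 'I_k := enum_val.
have finj : injective f by exact: enum_val_inj.
exists #|I|, (rowsub f M).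
  apply/row_freeP; exists (colsub f (pinvmx M)).
  have -> : rowsub f M *m colsub f (pinvmx M) = mxsub f f (M *m pinvmx M).
    by apply/matrixP => i j; rewrite !mxE; apply: eq_bigr => l _; rewrite !mxE.
  rewrite mulmxVp//; apply/matrixP => i j; rewrite !mxE.
  by rewrite (inj_eq finj).
apply/seteqP; split=> [x Fx|_ [c c0 <-]].
  have [c c0 cx] := FM Fx; exists (\row_i c 0 (f i)) => [i|]; first by rewrite mxE.
  rewrite -cx !mulmx_sum_row [RHS](bigID inF)/= [X in _ + X]big1 ?addr0; last first.
    by move=> i Fi; rewrite coef_inF ?scale0r// cx.
  rewrite [RHS](eq_bigl (mem I)); last by move=> i; rewrite !inE.
  rewrite [RHS]big_enum_val; apply: eq_bigr => i _.
  by rewrite mxE row_rowsub.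
rewrite mulmx_sum_row; apply: big_ind => [||i _].
- exact: cone0.
- exact: coneD.
- rewrite row_rowsub; apply: coneZ => //.
  by have := enum_valP i; rewrite inE => /asboolP.
Qed.

End SimplicialFaces.

Lemma lspan_cone C x : convex_cone C -> lspan C x ->
  exists y z, [/\ C y, C z & x = y - z].
Proof.
move=> cC; apply: (@lspan_min C [set x | exists y z, [/\ C y, C z & x = y - z]]).
- by move=> y Cy; exists y, 0; rewrite subr0; split => //; exact: cone0.
- by exists 0, 0; rewrite subr0; split => //; exact: cone0.
- move=> _ _ [a [b [Ca Cb ->]]] [d [e [Cd Ce ->]]].
  exists (a + d), (b + e); split; [exact: coneD|exact: coneD|].
  by rewrite opprD addrACA.
- move=> c _ [a [b [Ca Cb ->]]]; have [c0|/ltW c0] := leP 0 c.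
    by exists (c *: a), (c *: b); rewrite scalerBr; split => //; exact: coneZ.
  exists (- c *: b), (- c *: a); split; [| |by rewrite scalerBr !scaleNr opprK addrC];
    by apply: coneZ; rewrite ?oppr_ge0.
Qed.

Section Fan.
Variable S : set (set V).
Hypothesis fanS : simplicial_fan S.

Lemma fan_convex C : S C -> convex_cone C.
Proof. by move=> /(fan_simplicial fanS)[k]; exact: simplicial_convex. Qed.

Lemma proj_cone_sub s k t : S s -> S k -> S t -> s `<=` k -> s `<=` t ->
  proj_cone s k `<=` proj_cone s t -> k `<=` t.
Proof.
move=> Ss Sk St sk st kt x kx.
have [y ty /orth_proj_eq yx] := kt _ (ex_intro2 _ _ x kx erefl).
have [p [q [sp sq yxE]]] := lspan_cone (fan_convex Ss) yx.
have cxq : x + p = y + q.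
  by rewrite -[p](subrK q) -yxE addrA (addrC x) subrK.
have [] // := @face_extreme _ _ (fan_inter fanS Sk St) x p => //; first exact: sk.
split; first by apply: (coneD (fan_convex Sk)) => //; exact: sk.
by rewrite cxq; apply: (coneD (fan_convex St)) => //; exact: st.
Qed.

Lemma proj_cone_inj s k t : star S s k -> star S s t -> S s ->
  proj_cone s k = proj_cone s t -> k = t.
Proof.
move=> [Sk sk] [St st] Ss kt; apply/seteqP.
by split; apply: (@proj_cone_sub s) => //; rewrite kt.
Qed.

Lemma proj_coneS s k t1 t2 : lspan s `<=` lspan k ->
  proj_cone s t1 = proj_cone s t2 -> proj_cone k t1 = proj_cone k t2.
Proof.
suff sub t t' : lspan s `<=` lspan k -> proj_cone s t = proj_cone s t' ->
    proj_cone k t `<=` proj_cone k t'.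
  by move=> sk tt; apply/seteqP; split; apply: sub.
move=> sk tt _ [x tx <-].
have : proj_cone s t (orth_proj s x) by exists x.
rewrite tt => -[y ty /orth_proj_eq yx]; exists y => //.
by apply/orth_proj_eq/sk.
Qed.

Lemma proj_cone_self s : S s -> proj_cone s s = [set 0].
Proof.
move=> Ss; apply/seteqP; split=> [_ [x sx <-]|_ ->].
  apply: orth_proj_uniq; last by rewrite subr0; exact: lspan_sub.
  by move=> y _; rewrite dot0r.
exists 0; first exact: (cone0 (fan_convex Ss)).
by apply: orth_proj_uniq; [move=> y _; rewrite dot0r|rewrite subr0; exact: lspan0].
Qed.

Variable P : set (set (set V)).
Hypothesis admP : admissible_partition S P.

Lemma block_sub B s : P B -> B s -> S s.
Proof.
by move=> PB Bs; have [<- _ _] := adm_partition admP; exists B.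
Qed.

Lemma block_uniq A B s : P A -> P B -> A s -> B s -> A = B.
Proof.
move=> PA PB As Bs; have [_ trivP _] := adm_partition admP.
by apply: trivP => //; exists s.
Qed.

Lemma same_blockP B s t : P B -> B s -> same_block P s t -> B t.
Proof. by move=> PB Bs [A PA [As At]]; rewrite (block_uniq PB PA Bs As). Qed.

Lemma block_lspan B s1 s2 : P B -> B s1 -> B s2 -> lspan s1 = lspan s2.
Proof.
move=> PB B1 B2; have [s Ss Bs] := adm_block admP PB.
have [_ e1 _] := Bs _ B1; have [_ e2 _] := Bs _ B2.
by apply: orthocomp_eq_lspan; rewrite -e1 e2.
Qed.

Lemma block_proj B s1 s2 : P B -> B s1 -> B s2 -> proj_cone s1 = proj_cone s2.
Proof.
move=> PB B1 B2; rewrite /proj_cone.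
by rewrite (orth_proj_lspan (block_lspan PB B1 B2)).
Qed.

Lemma block_lift B s1 s2 t1 : P B -> B s1 -> B s2 -> star S s1 t1 ->
  exists2 t2, star S s2 t2 & proj_cone s2 t2 = proj_cone s1 t1 /\
    same_block P t1 t2.
Proof.
move=> PB B1 B2 st1; have [s Ss Bs] := adm_block admP PB.
have [_ _ e1] := Bs _ B1; have [_ _ e2] := Bs _ B2.
have : proj_star S s1 (proj_cone s1 t1) by exists t1.
rewrite -e1 e2 => -[t2 st2 e]; exists t2 => //; split => //.
by apply: (@adm_admissible _ _ admP s1 s2) => //; exists B.
Qed.

Lemma proj_comp A B s1 k1 t1 s2 k2 t2 : P A -> P B ->
    A s1 -> A s2 -> B k1 -> B k2 -> S t1 -> S t2 ->
    s1 `<=` k1 -> k1 `<=` t1 -> s2 `<=` k2 -> k2 `<=` t2 ->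
    proj_cone s1 k1 = proj_cone s2 k2 -> proj_cone k1 t1 = proj_cone k2 t2 ->
  proj_cone s1 t1 = proj_cone s2 t2.
Proof.
move=> PA PB A1 A2 B1 B2 S1 S2 s1k k1t s2k k2t sk kt.
have s1t : star S s1 t1 by split => //; exact: subset_trans k1t.
have [t [St s2t] [e _]] := block_lift PA A1 A2 s1t.
have Ss2 := block_sub PA A2; have Sk2 := block_sub PB B2.
have k2t' : k2 `<=` t.
  apply: (@proj_cone_sub s2) => //; rewrite e -sk.
  exact: image_subset.
suff -> : t2 = t by rewrite e.
apply: (@proj_cone_inj k2) => //.
rewrite -kt (block_proj PB B1 B2); apply: (@proj_coneS s2); first exact: lspanS.
by rewrite e (block_proj PA A1 A2).
Qed.

(* The class of [f_{s t}] among the morphisms from the block [A] to the block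
   [B]; the arrow [f_{s t}] of the poset [S] is encoded by the pair [(s, t)]. *)
Definition mor_class (A B : set (set V)) (s t : set V) : set (set V * set V) :=
  [set p | [/\ A p.1, B p.2, p.1 `<=` p.2 & proj_cone p.1 p.2 = proj_cone s t]].

Definition is_mor (A B : set (set V)) (c : set (set V * set V)) : Prop :=
  exists s t, [/\ A s, B t, s `<=` t & c = mor_class A B s t].

(* The identity of [A] is the class of [f_{s s}] for any [s] in [A], which
   consists of the [f_{s s}] with [s] in [A]; see [mor_idE]. *)
Definition mor_id (A : set (set V)) : set (set V * set V) :=
  [set p | A p.1 /\ p.1 = p.2].

(* All composites of composable representatives; [mor_compE] shows that this
   is the class of [f_{s t}] when [c] and [d] are those of [f_{s k}] and
   [f_{k t}]. *)
Definition mor_comp (d c : set (set V * set V)) : set (set V * set V) :=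
  [set p | exists2 k, c (p.1, k) & d (k, p.2)].

Lemma mor_idE A s : P A -> A s -> mor_id A = mor_class A A s s.
Proof.
move=> PA As; apply/seteqP; split=> [[x _] [/= Ax <-]|[x y] [/= Ax Ay xy e]].
  split=> //=.
  by rewrite !proj_cone_self//; apply: block_sub; eassumption.
split=> //=; have Sx := block_sub PA Ax.
have xyS : star S x y by split => //; exact: block_sub Ay.
apply: (@proj_cone_inj x) => //; first by split.
by rewrite e !proj_cone_self//; exact: block_sub As.
Qed.

Lemma mor_compE A B C s k t : P A -> P B -> P C -> A s -> B k -> C t ->
    s `<=` k -> k `<=` t ->
  mor_comp (mor_class B C k t) (mor_class A B s k) = mor_class A C s t.
Proof.
move=> PA PB PC As Bk Ct sk kt; have St := block_sub PC Ct.
apply/seteqP; split=> [[x z] [y [/= Ax By xy e] [/= _ Cz yz e']]|].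
  split=> //=; first exact: subset_trans yz.
  by apply: (@proj_comp A B x y z s k t) => //; exact: block_sub Cz.
move=> [x z] [/= Ax Cz xz e].
have Sk := block_sub PB Bk; have Sx := block_sub PA Ax.
have [y [Sy xy] [ey /(same_blockP PB Bk) By]] :=
  block_lift PA As Ax (conj Sk sk).
exists y; first by split.
split=> //=.
  apply: (@proj_cone_sub x) => //; first exact: block_sub Cz.
  by rewrite ey e; exact: image_subset.
rewrite -(block_proj PB By Bk); apply: (@proj_coneS x); first exact: lspanS.
by rewrite e (block_proj PA Ax As).
Qed.

Lemma is_mor_id A : P A -> is_mor A A (mor_id A).
Proof.
move=> PA; have [_ _ /(_ A PA)[s As]] := adm_partition admP.
by exists s, s; split => //; exact: mor_idE.
Qed.

Lemma is_mor_comp A B C d c : P A -> P B -> P C ->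
  is_mor B C d -> is_mor A B c -> is_mor A C (mor_comp d c).
Proof.
move=> PA PB PC [k' [t' [Bk' Ct' kt' ->]]] [s [k [As Bk sk ->]]].
have St' := block_sub PC Ct'.
have [t [St kt] [e /(same_blockP PC Ct') Ct]] :=
  block_lift PB Bk' Bk (conj St' kt').
have -> : mor_class B C k' t' = mor_class B C k t by rewrite /mor_class e.
exists s, t; split => //; first exact: subset_trans kt.
exact: mor_compE.
Qed.

Definition block : Type := {A : set (set V) | P A}.

Definition block_hom (A B : block) : Type :=
  {c : set (set V * set V) | is_mor (sval A) (sval B) c}.

Definition block_id (A : block) : block_hom A A :=
  exist _ _ (is_mor_id (svalP A)).

Definition block_comp (A B C : block) (d : block_hom B C) (c : block_hom A B) :
    block_hom A C :=
  exist _ _ (is_mor_comp (svalP A) (svalP B) (svalP C) (svalP d) (svalP c)).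

Lemma block_compA A B C D (h : block_hom C D) (g : block_hom B C)
    (f : block_hom A B) :
  block_comp h (block_comp g f) = block_comp (block_comp h g) f.
Proof.
apply: eq_exist; apply/seteqP.
split=> [[x w] [z [y fxy gyz] hzw]|[x w] [y fxy [z gyz hzw]]].
- by exists y => //; exists z.
- by exists z => //; exists y.
Qed.

Lemma block_comp1m A B (f : block_hom A B) : block_comp (block_id B) f = f.
Proof.
case: f => f [s [t [As Bt st fE]]]; apply: eq_exist => /=.
apply/seteqP; split=> [[x z] [y fxy [/= _ <-]]//|[x z] fxz].
by exists z => //; split => //=; move: fxz; rewrite fE => -[].
Qed.

Lemma block_compm1 A B (f : block_hom A B) : block_comp f (block_id A) = f.
Proof.
case: f => f [s [t [As Bt st fE]]]; apply: eq_exist => /=.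
apply/seteqP; split=> [[x z] [y [/= _ ->]]//|[x z] fxz].
by exists x => //; split => //=; move: fxz; rewrite fE => -[].
Qed.

Definition partition_category : category :=
  Category block_compA block_comp1m block_compm1.

End Fan.

Record central_arrangement (H : set (set V)) : Prop := CentralArrangement {
  arr_finite : finite_set H;
  arr_linear : forall h, H h -> exists2 a, a != 0 & h = hyperplane a }.

Definition arr_complement (H : set (set V)) : set V := ~` \bigcup_(h in H) h.

Definition regions (H : set (set V)) : set (set V) :=
  connected_component (arr_complement H) @` arr_complement H.

Record simplicial_arrangement (H : set (set V)) : Prop := SimplicialArrangement {
  simp_arr : central_arrangement H;
  simp_region : forall C, regions H C -> simplicial_cone n (closure C) }.

Definition arrangement_fan (H : set (set V)) : set (set V) :=
  [set F | exists2 C, regions H C & face (closure C) F].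

Definition normals_in_orthant (H : set (set V)) : Prop :=
  forall h, H h -> exists a, [/\ a != 0, orthant n a & h = hyperplane a].

Lemma hyperplaneN a : hyperplane (- a) = hyperplane a.
Proof.
apply/seteqP; split=> x; rewrite /hyperplane /= dotNl.
  by move=> /eqP; rewrite oppr_eq0 => /eqP.
by move=> ->; rewrite oppr0.
Qed.

Lemma continuous_dot a : continuous (dot a : V -> R).
Proof.
have -> : dot a = (fun x : V => \sum_i a 0 i * x 0 i).
  by apply/funext => x; exact: dotE.
elim: (index_enum _) => [|i s IH] x.
  by under eq_fun do rewrite big_nil; exact: cst_continuous.
have -> : (fun y : V => \sum_(j <- i :: s) a 0 j * y 0 j) =
    (fun y : V => a 0 i * y 0 i) \+ (fun y : V => \sum_(j <- s) a 0 j * y 0 j).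
  by apply/funext => y; rewrite big_cons.
apply: continuousD; last exact: IH.
by apply: continuousM; [exact: cst_continuous|exact: coord_continuous].
Qed.

Lemma continuous_line x y : continuous (fun t : R => y + t *: x).
Proof.
move=> t B [P PP PB].
have : \forall u \near t, forall ij : 'I_1 * 'I_n, P ij.1 ij.2 ((y + u *: x) ij.1 ij.2).
  apply: (@filter_forall _ _ (fun (ij : 'I_1 * 'I_n) (u : R) =>
    P ij.1 ij.2 ((y + u *: x) ij.1 ij.2)) (nbhs t)) => -[i j] /=.
  have cf : continuous (fun u : R => y i j + u * x i j).
    move=> u; apply: cvgD; first exact: cvg_cst.
    by apply: cvgM; [exact: cvg_id|exact: cvg_cst].
  have := PP i j; rewrite !mxE => /(cf t) Pij.
  apply: (@filterS _ (nbhs t) _ ((fun u : R => y i j + u * x i j) @^-1` P i j)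
    _ _ Pij).
  by move=> u; rewrite /= !mxE.
move=> Q; change (nbhs t ((fun u : R => y + u *: x) @^-1` B)).
apply: (@filterS _ (nbhs t) _ _ ((fun u : R => y + u *: x) @^-1` B) _ Q).
by move=> u Pu; apply: PB => i j; exact: (Pu (i, j)).
Qed.

Section ArrangementFan.
Variable H : set (set V).
Hypothesis arrH : central_arrangement H.

Let cell x : set V :=
  [set y | forall a, H (hyperplane a) -> 0 < dot a x -> 0 < dot a y].

Let dot_neq0 x a : arr_complement H x -> H (hyperplane a) -> dot a x != 0.
Proof. by move=> Hx Ha; apply/eqP => ax; apply: Hx; exists (hyperplane a). Qed.

Lemma regionE x : arr_complement H x ->
  connected_component (arr_complement H) x = cell x.
Proof.
move=> Hx; apply/seteqP; split=> [y [D [Dx DH cD] Dy] a Ha ax|].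
  rewrite ltNge; apply/negP => ay.
  have /connected_intervalP : connected (dot a @` D).
    apply: connected_continuous_connected => //.
    exact/continuous_subspaceT/continuous_dot.
  move=> /(_ (dot a y) (dot a x)) int.
  have [] := int _ _ 0; [by exists y|by exists x|by rewrite ay ltW|].
  by move=> z Dz az; apply: (DH _ Dz); exists (hyperplane a).
have cx : cell x x by [].
apply: connected_component_max => //.
  move=> y xy [h Hh hy]; have [a a0 hE] := arr_linear arrH Hh; rewrite {}hE in Hh hy.
  have := dot_neq0 Hx Hh; rewrite neq_lt => /orP[ax|ax].
    have := xy (- a); rewrite hyperplaneN !dotNl !oppr_gt0 => /(_ Hh ax).
    by rewrite hy ltxx.
  by have := xy _ Hh ax; rewrite hy ltxx.
have -> : cell x = \bigcup_(y in cell x)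
    ((fun t : R => x + t *: (y - x)) @` `[0, 1]%classic).
  apply/seteqP; split=> [y xy|_ [y xy [t t01 <-]]].
    exists y => //; exists 1; first by rewrite /= in_itv /= ler01 lexx.
    by rewrite scale1r addrC subrK.
  move: t01; rewrite /= in_itv /= => /andP[t0 t1] a Ha ax.
  rewrite dotDr dotZr dotBr.
  have -> : dot a x + t * (dot a y - dot a x) =
      (1 - t) * dot a x + t * dot a y by rewrite mulrBr mulrBl mul1r addrA addrAC.
  have ay := xy _ Ha ax.
  have [->|t0'] := eqVneq t 0; first by rewrite subr0 mul1r mul0r addr0.
  apply: ltr_wpDl; first by rewrite mulr_ge0 ?subr_ge0// ltW.
  by rewrite mulr_gt0// lt_neqAle eq_sym t0'.
apply: bigcup_connected.
  exists x => y _; exists 0; first by rewrite /= in_itv /= ler01 lexx.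
  by rewrite scale0r addr0.
move=> y _; apply: connected_continuous_connected; first exact: segment_connected.
exact/continuous_subspaceT/continuous_line.
Qed.

Lemma closure_regionE x : arr_complement H x ->
  closure (connected_component (arr_complement H) x) =
  [set y | forall a, H (hyperplane a) -> 0 < dot a x -> 0 <= dot a y].
Proof.
move=> Hx; rewrite regionE//; apply/seteqP; split=> [y yc a Ha ax|y xy B yB].
  have cl : closed [set z : V | 0 <= dot a z].
    by apply: (@closed_comp _ _ (dot a) [set r : R | 0 <= r]) => [z _|];
      [exact: continuous_dot|exact: closed_ge].
  apply: cl; move: y yc; apply: closureS => z zx; exact/ltW/zx.
have yB' : nbhs (y + 0 *: x) B by rewrite scale0r addr0.
have := @continuous_line x y 0 B yB'.
move=> /nbhs_ballP[e /= e0 eB].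
have e2 : 0 < e / 2 by rewrite divr_gt0.
exists (y + (e / 2) *: x); split.
  move=> a Ha ax; rewrite dotDr dotZr; apply: ltr_wpDl; first exact: xy.
  by rewrite mulr_gt0.
apply: eB; rewrite /ball /= sub0r normrN gtr0_norm//.
by rewrite ltr_pdivrMr// ltr_pMr// ltr1n.
Qed.

End ArrangementFan.

Lemma arrangement_fanP H : simplicial_arrangement H ->
  simplicial_fan (arrangement_fan H).
Proof.
move=> [arrH simpH].
have key C F G : regions H C -> face (closure C) F -> convex_cone G ->
    G `<=` F -> extreme F G ->
    face (closure C) G /\ exists k, simplicial_cone k G.
  move=> HC CF cG GF eG; have [M Mfree CM] := simpH _ HC.
  have GC := subset_trans GF (face_sub CF).
  have eCG : extreme (closure C) G.
    move=> x y Cx Cy Gxy; have Fxy := GF _ Gxy.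
    apply: (eG _ y) => //; first exact: face_extreme CF _ _ Cx Cy Fxy.
    by rewrite addrC in Fxy; exact: face_extreme CF _ _ Cy Cx Fxy.
  rewrite CM in GC eCG *; split; first exact: extreme_face.
  exact: (extreme_simplicial Mfree cG GC eCG).
have cF C F : regions H C -> face (closure C) F -> convex_cone F.
  by move=> HC; apply: face_convex; exact: simplicial_convex (simpH _ HC).
split.
- move=> F [C HC CF].
  by have [] // := key C F F HC CF (cF _ _ HC CF) (@subset_refl _ F) _.
- move=> F G [C HC CF] FG; exists C => //.
  have cFF := cF _ _ HC CF.
  have [] // := key C F G HC CF (face_convex cFF FG) (face_sub FG) _.
  exact: face_extreme.
- move=> F1 F2 [C1 HC1 CF1] [C2 HC2 CF2].
  have cF1 := cF _ _ HC1 CF1; have cF2 := cF _ _ HC2 CF2.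
  have [k [M Mfree F1M]] : exists k, simplicial_cone k F1.
    by have [] // := key C1 F1 F1 HC1 CF1 cF1 (@subset_refl _ F1) _.
  suff eF : extreme F1 (F1 `&` F2).
    rewrite F1M in eF cF1 *; apply: extreme_face => //.
    split=> [|x y [? ?] [? ?]|c x c0 [? ?]]; split;
      by [exact: cone0|exact: coneD|exact: coneZ].
  have C12 x y : F1 x -> F1 y -> F2 (x + y) -> closure C2 x.
    move=> F1x F1y F2xy; have := face_sub CF2 F2xy.
    have := face_sub CF1 F1y; have := face_sub CF1 F1x.
    have [x1 Hx1 <-] := HC1; have [x2 Hx2 <-] := HC2.
    rewrite !closure_regionE// => C1x C1y C2xy a Ha ax2.
    have : dot a x1 != 0 by apply/eqP => ax; apply: Hx1; exists (hyperplane a).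
    rewrite neq_lt => /orP[ax1|/(C1x _ Ha)//].
    have HNa : H (hyperplane (- a)) by rewrite hyperplaneN.
    have := C1y _ HNa; rewrite !dotNl !oppr_ge0 oppr_gt0 => /(_ ax1) ay.
    have := C2xy _ Ha ax2; rewrite dotDr => axy.
    by apply: le_trans axy _; rewrite gerDl.
  move=> x y F1x F1y [F1xy F2xy]; split => //.
  apply: (face_extreme CF2 (y := y)) => //; first exact: (C12 x y).
  by apply: (C12 y x) => //; rewrite addrC.
Qed.

End Euclidean.

(* Main.v *)
Require Import Defs.
From HB Require Import structures.
From mathcomp Require Import all_boot all_order all_algebra.
From mathcomp Require Import all_classical all_reals all_analysis.

Set Implicit Arguments.
Unset Strict Implicit.
Unset Printing Implicit Defensive.

(** Every morphism of the category comes from an inclusion of cones [s `<=` t],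
and it remembers the projection of [t] along the span of [s]. Hence it
remembers, for each normal [a] of the arrangement with [s] inside the
hyperplane of [a], whether [t] has points on the positive side of that
hyperplane ([dot_orth_proj]). Recording these normals by their indicator
function gives a map to the additive group of integer-valued functions on the
space, and this map is the required functor.

It is additive on [s `<=` k `<=` t]. A normal that vanishes on [s] but is
positive somewhere on [t] either vanishes on [k], and is then recorded by
[k `<=` t] alone, or it is nonzero at some point of [k]. In the second case [t]
lies on one side of the hyperplane ([fan_one_sided]), so that [k] is positive
exactly when [t] is, and only [s `<=` k] records the normal.

It is faithful because, by the lifting property of blocks, two parallel
morphisms are represented by cones [t1] and [t2] containing the same [s]. Normals
not vanishing on [s] take the same sign on both cones, and the others take the
same sign as soon as the values of the functor agree. So each cone lies in the
closed region of which the other is a face; as the cones belong to one block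
they have the same span, and a face is cut out of its region by its span
([fan_sub_positive]). *)

Import Order.TTheory GRing.Theory Num.Theory.
Import numFieldNormedType.Exports.

Local Open Scope classical_set_scope.
Local Open Scope ring_scope.

(** A type synonym, so that the multiplicative notation of groups stands for
the addition of [A]. *)
Definition additive_group (A : zmodType) : Type := A.

HB.instance Definition _ (A : zmodType) := Choice.on (additive_group A).
HB.instance Definition _ (A : zmodType) := isGroup.Build (additive_group A)
  (@addrA A) (@add0r A) (@addr0 A) (@addNr A) (@addrN A).

Section PositiveNormals.
Variables (R : realType) (n : nat).
Local Notation V := 'rV[R]_n.
Implicit Types (a x y : V) (s k t : set V).

Definition positive a t : Prop := exists2 x, t x & 0 < dot a x.

Lemma positiveS a s t : s `<=` t -> positive a s -> positive a t.
Proof. by move=> st [x sx ax]; exists x => //; exact: st. Qed.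

Lemma hyperplane_lspan a s : s `<=` hyperplane a -> lspan s `<=` hyperplane a.
Proof.
move=> sa x /(@orthocomp_lspan _ _ s a); rewrite /hyperplane/= dotC; apply.
by move=> y /sa; rewrite /hyperplane/= dotC.
Qed.

Lemma dot_orth_proj a s x : s `<=` hyperplane a ->
  dot a (orth_proj s x) = dot a x.
Proof.
move=> /hyperplane_lspan sa; have [_ /sa] := orth_projP s x.
by rewrite /hyperplane/= dotBr => /eqP; rewrite subr_eq0 => /eqP.
Qed.

Lemma positive_proj_cone a s t : s `<=` hyperplane a ->
  positive a (proj_cone s t) <-> positive a t.
Proof.
move=> sa; split=> [[_ [x tx <-]]|[x tx ax]].
  by rewrite dot_orth_proj// => ax; exists x.
by exists (orth_proj s x); [exists x|rewrite dot_orth_proj].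
Qed.

Section Faces.
Variable H : set (set V).
Hypothesis arrH : central_arrangement H.

(** A region is connected and misses the hyperplane, so its closure, and with
it every face, stays on one side. *)
Lemma fan_one_sided a t x y : arrangement_fan H t -> H (hyperplane a) ->
  t x -> t y -> 0 < dot a x -> 0 <= dot a y.
Proof.
move=> [_ [z Hz <-] /face_sub tC] Ha /tC + /tC.
rewrite closure_regionE// => xC yC ax.
have : dot a z != 0 by apply/eqP => az; apply: Hz; exists (hyperplane a).
rewrite neq_lt => /orP[az|/(yC _ Ha)//].
(* [x] lies in the closed region of [z], so [a] cannot separate them. *)
have := xC (- a); rewrite hyperplaneN !dotNl oppr_gt0 => /(_ Ha az).
by rewrite oppr_ge0 leNgt ax.
Qed.

(** A cone [t] on one side of the hyperplane cannot have a subcone [s] that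
meets only the other open side, so a subcone off the hyperplane already decides
the side of [t]. *)
Lemma fan_positive a s t : arrangement_fan H t -> H (hyperplane a) ->
  s `<=` t -> ~ s `<=` hyperplane a -> positive a s <-> positive a t.
Proof.
move=> Ft Ha st sa; split; first exact: positiveS.
move=> [x tx ax]; apply: contrapT => sN; apply: sa => y sy.
rewrite /hyperplane/=; apply/eqP; rewrite eq_le.
rewrite (fan_one_sided Ft Ha tx (st _ sy) ax) andbT leNgt.
by apply/negP => ay; apply: sN; exists y.
Qed.

(** The sign condition places [t2] in the closed region of which [t1] is a
face: a point of [t2] on the wrong side of some hyperplane would make the
opposite normal positive on [t2], hence on [t1]. The face [t1] is the
intersection of that region with a hyperplane, which contains the span of
[t1]. *)
Lemma fan_sub_positive t1 t2 : arrangement_fan H t1 ->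
    (forall a, H (hyperplane a) -> positive a t2 -> positive a t1) ->
  lspan t2 `<=` lspan t1 -> t2 `<=` t1.
Proof.
move=> [_ [z Hz <-] t1C] pos t21 y ty.
have yC : closure (connected_component (arr_complement H) z) y.
  rewrite closure_regionE// => a Ha az; rewrite leNgt; apply/negP => ay.
  have HNa : H (hyperplane (- a)) by rewrite hyperplaneN.
  have [|x /(face_sub t1C) + ax] := pos _ HNa.
    by exists y => //; rewrite dotNl oppr_gt0.
  rewrite closure_regionE// => /(_ a Ha az).
  by move: ax; rewrite dotNl oppr_gt0 leNgt => ->.
have [u _ t1E] := t1C; rewrite t1E; split => //.
apply: (@hyperplane_lspan u t1); first by rewrite t1E; exact: subIsetr.
exact/t21/lspan_sub.
Qed.

End Faces.

Section Functor.
Variables (H : set (set V)) (simpH : simplicial_arrangement H).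
Variables (P : set (set (set V))).
Hypothesis admP : admissible_partition (arrangement_fan H) P.
Let arrH := simp_arr simpH.
Let fanH := arrangement_fanP simpH.

Definition new_positive s t : set V :=
  [set a | [/\ H (hyperplane a), s `<=` hyperplane a & positive a t]].

(** The union over all representatives makes independence of the choice a
lemma, [class_new_positiveE], in which any one representative suffices. *)
Definition class_new_positive (c : set (set V * set V)) : set V :=
  \bigcup_(p in c) new_positive p.1 p.2.

(** Projecting along the span of [s] does not change the product with a normal
vanishing on [s], so the signs on [t] can be read off from its projection. *)
Lemma new_positive_lspan s1 t1 s2 t2 : lspan s1 = lspan s2 ->
    proj_cone s1 t1 = proj_cone s2 t2 ->
  new_positive s1 t1 `<=` new_positive s2 t2.
Proof.
move=> s12 t12 a [Ha s1a pos].
have s2a : s2 `<=` hyperplane a.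
  by move=> x /lspan_sub; rewrite -s12; exact: hyperplane_lspan.
split=> //; apply/(positive_proj_cone _ s2a).
by rewrite -t12; apply/(positive_proj_cone _ s1a).
Qed.

Lemma class_new_positiveE A B s t : P A -> A s -> B t -> s `<=` t ->
  class_new_positive (mor_class A B s t) = new_positive s t.
Proof.
move=> PA As Bt st; apply/seteqP; split=> [a [[s' t'] [/= As' _ _ e]]|a sta].
  by apply: new_positive_lspan => //; exact: (block_lspan admP PA).
by exists (s, t).
Qed.

Lemma new_positive_id s : new_positive s s = set0.
Proof.
apply/seteqP; split=> // a [_ sa [x /sa]].
by rewrite /hyperplane/= => ->; rewrite ltxx.
Qed.

Definition weight (c : set (set V * set V)) : additive_group (V -> int) :=
  fun a => (`[< class_new_positive c a >])%:R.

Lemma weight_eq_class c d : weight c = weight d ->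
  class_new_positive c = class_new_positive d.
Proof.
move=> w; apply/funext => a; apply/propext.
apply: asbool_eq_equiv; have := congr1 (@^~ a) w; rewrite /weight.
by case: `[< _ >]; case: `[< _ >].
Qed.

Lemma weight_idE A : P A -> weight (mor_id A) = 1%g.
Proof.
move=> PA; apply/funext => a.
have [s [_ [As _ _ _]]] := is_mor_id fanH admP PA.
rewrite /weight (mor_idE fanH admP PA As) class_new_positiveE// new_positive_id.
by rewrite asboolF.
Qed.

(** The two terms on the right are never both [1]: a normal counted by the first
vanishes on [k], one counted by the second does not. *)
Lemma new_positive_comp s k t a : arrangement_fan H t -> s `<=` k -> k `<=` t ->
  (`[< new_positive s t a >])%:R =
  (`[< new_positive k t a >])%:R + (`[< new_positive s k a >])%:R :> int.
Proof.
move=> Ft sk kt.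
have [ka|ka] := pselect (k `<=` hyperplane a).
  have -> : `[< new_positive s k a >] = false.
    apply: asboolF => -[_ _ [x /ka]].
    by rewrite /hyperplane/= => ->; rewrite ltxx.
  rewrite addr0; congr (_ %:R); congr nat_of_bool; apply: asbool_equiv_eq.
  by split=> -[Ha _ pos]; split=> //; exact: subset_trans ka.
have -> : `[< new_positive k t a >] = false by apply: asboolF => -[].
rewrite add0r; congr (_ %:R); congr nat_of_bool; apply: asbool_equiv_eq.
by split=> -[Ha sa /(fan_positive arrH Ft Ha kt ka) pos].
Qed.

Lemma weight_comp A B C d c : P A -> P B -> P C ->
    is_mor B C d -> is_mor A B c ->
  weight (mor_comp d c) = (weight d * weight c)%g.
Proof.
move=> PA PB PC [k' [t' [Bk' Ct' kt' ->]]] [s [k [As Bk sk ->]]].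
(* The two representatives only share the block of their middle cone; the
   second one is transported so that it starts at [k]. *)
have St' := block_sub admP PC Ct'.
have [t [St kt] [e /(same_blockP admP PC Ct') Ct]] :=
  block_lift admP PB Bk' Bk (conj St' kt').
have -> : mor_class B C k' t' = mor_class B C k t by rewrite /mor_class e.
rewrite (mor_compE fanH admP PA PB PC)//; apply/funext => a.
rewrite /weight !class_new_positiveE//; first exact: new_positive_comp.
exact: subset_trans kt.
Qed.

(** Once both morphisms start at the same cone [s], only the upper cones [t] and
[u] are left to compare; they lie in one block, hence have the same span, and
by [fan_sub_positive] it remains to see that the same normals of the
arrangement are positive on them. *)
Lemma weight_inj A B c d : P A -> P B -> is_mor A B c -> is_mor A B d ->
  weight c = weight d -> c = d.
Proof.
move=> PA PB [s [t [As Bt st ->]]] [s' [t' [As' Bt' st' ->]]].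
have St' := block_sub admP PB Bt'; have St := block_sub admP PB Bt.
have [u [Su su] [e /(same_blockP admP PB Bt') Bu]] :=
  block_lift admP PA As' As (conj St' st').
have -> : mor_class A B s' t' = mor_class A B s u by rewrite /mor_class e.
move=> w; suff -> : t = u by [].
have tu : new_positive s t = new_positive s u.
  rewrite -(class_new_positiveE PA As Bt)// -(class_new_positiveE PA As Bu)//.
  exact: weight_eq_class.
have pos t1 t2 a : arrangement_fan H t1 -> arrangement_fan H t2 ->
    s `<=` t1 -> s `<=` t2 -> new_positive s t1 = new_positive s t2 ->
    H (hyperplane a) -> positive a t1 -> positive a t2.
  move=> F1 F2 s1 s2 e12 Ha p1.
  (* The weight sees only the normals vanishing on [s]; for the others the
     sign is already fixed by [s]. *)
  have [sa|sa] := pselect (s `<=` hyperplane a).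
    have : new_positive s t1 a by [].
    by rewrite e12 => -[].
  by apply/(fan_positive arrH F2 Ha s2 sa)/(fan_positive arrH F1 Ha s1 sa).
have sp := block_lspan admP PB Bt Bu.
apply/seteqP; split; apply: (@fan_sub_positive H) => //; rewrite ?sp// => a Ha.
  exact: pos.
exact: pos.
Qed.

Definition weight_functor : functor (partition_category fanH admP)
    (group_category (additive_group (V -> int))) :=
  @Functor (partition_category fanH admP)
    (group_category (additive_group (V -> int)))
    (fun=> tt) (fun A B c => weight (sval c))
    (fun A => weight_idE (svalP A))
    (fun A B C d c => weight_comp (svalP A) (svalP B) (svalP C)
       (svalP d) (svalP c)).

Lemma weight_functor_faithful : faithful weight_functor.
Proof.
move=> A B [c mc] [d md] w; apply: eq_exist.
exact: (weight_inj (svalP A) (svalP B) mc md w).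
Qed.

End Functor.
End PositiveNormals.

Theorem theorem1p4 (R : realType) (n : nat) (H : set (set 'rV[R]_n))
    (simpH : simplicial_arrangement H) (posH : normals_in_orthant H)
    (P : set (set (set 'rV[R]_n)))
    (admP : admissible_partition (arrangement_fan H) P) :
  exists (G : groupType)
    (F : functor (partition_category (arrangement_fanP simpH) admP)
                 (group_category G)),
    faithful F.
Proof.
by eexists; exists (weight_functor simpH admP); exact: weight_functor_faithful.
Qed.
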